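(* Let $t\ge 1$, let $r\ge 3$, and let $p_i, q_i$ be integers with $p_i, q_i\ge r-1$ for all $1\le i\le t$. Then $$gr(K_{\max(p_1,q_1)+1}^{(r)}, K_{\max(p_2,q_2)+1}^{(r)}, \dots, K_{\max(p_{t-1},q_{t-1})+1}^{(r)}, K_{p_tq_t+1}^{(r)};r)$$ $$\ge \left(gr(K_{p_1+1}^{(r)}, K_{p_2+1}^{(r)}, \dots, K_{p_t+1}^{(r)};r)-1\right)\left(gr(K_{q_1+1}^{(r)}, K_{q_2+1}^{(r)}, \dots, K_{q_t+1}^{(r)};r)-1\right)+1.$$
   Context: An $r$-uniform hypergraph $H=(V,E)$ consists of a nonempty finite set $V$ of vertices and a set $E$ of hyperedges, which are (distinct) $r$-element subsets of $V$. $K_n^{(r)}$ denotes the complete $r$-uniform hypergraph of order $n$ (every $r$-element subset of the vertex set is a hyperedge; no hyperedges if $n<r$). A $t$-coloring of an $r$-uniform hypergraph $H$ is a function $E(H)\to\{1,2,\dots,t\}$. A hypergraph is rainbow under a coloring if all of its hyperedges receive pairwise distinct colors. A Gallai $t$-coloring of $K_n^{(r)}$ is a $t$-coloring that contains no rainbow subhypergraph isomorphic to $K_{r+1}^{(r)}$. For $r$-uniform hypergraphs $H_1,\dots,H_t$, the Gallai-Ramsey number $gr(H_1,\dots,H_t;r)$ is the least natural number $p$ such that every Gallai $t$-coloring of $K_p^{(r)}$ contains, for some $i\in\{1,\dots,t\}$, a (not necessarily induced) subhypergraph isomorphic to $H_i$ all of whose hyperedges have color $i$. *)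

(* Defs.v *)
From HB Require Import structures.
From mathcomp Require Import all_boot.

Set Implicit Arguments.
Unset Strict Implicit.
Unset Printing Implicit Defensive.

(* The vertex type may be empty, so that K_n is also defined for n = 0. *)
Record hypergraph (r : nat) := Hypergraph {
  vertex : finType;
  hyperedges : {set {set vertex}};
  hyperedges_uniform : forall e, e \in hyperedges -> #|e| = r
}.

Arguments hyperedges {r} h.

Definition edge (r : nat) (G : hypergraph r) : finType :=
  {e : {set vertex G} | e \in hyperedges G}.

Lemma complete_uniform (r n : nat) (e : {set 'I_n}) :
  e \in [set e : {set 'I_n} | #|e| == r] -> #|e| = r.
Proof. by rewrite inE => /eqP. Qed.

Definition complete (r n : nat) : hypergraph r :=
  Hypergraph (@complete_uniform r n).

Definition coloring (t r : nat) (G : hypergraph r) : finType :=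
  {ffun edge G -> 'I_t}.

(* S is the hyperedge set of a (not necessarily induced) subhypergraph of G
   isomorphic to F; the vertex set of that subhypergraph is the image of f. *)
Definition is_copy (r : nat) (F G : hypergraph r) (S : {set edge G}) : bool :=
  [exists f : {ffun vertex F -> vertex G},
     injectiveb f &&
     ([set val e | e in S] == [set f @: (e : {set vertex F}) | e in hyperedges F])].

Definition rainbow (t r : nat) (G : hypergraph r) (c : coloring t G)
    (S : {set edge G}) : bool :=
  dinjectiveb c [in S].

Definition monochromatic (t r : nat) (G : hypergraph r) (c : coloring t G)
    (i : 'I_t) (S : {set edge G}) : bool :=
  [forall e in S, c e == i].

Definition gallai (t r : nat) (G : hypergraph r) (c : coloring t G) : bool :=
  [forall S : {set edge G}, is_copy (complete r r.+1) S ==> ~~ rainbow c S].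

Definition gallai_ramsey (t r : nat) (H : 'I_t -> hypergraph r) (p : nat) : bool :=
  [forall c : coloring t (complete r p), gallai c ==>
     [exists i : 'I_t, exists S : {set edge (complete r p)},
        is_copy (H i) S && monochromatic c i S]].

(* Ramsey's theorem for uniform hypergraphs, needed for the minimum defining
   gr to exist. *)

Fixpoint prehomogeneous (r : nat) (C : eqType) (T : finType)
    (c : {set T} -> C) (s : seq (T * C)) : Prop :=
  if s is p :: s' then
    (forall e : {set T}, {subset e <= map fst s'} -> #|e| = r ->
       c (p.1 |: e) = p.2) /\ prehomogeneous r c s'
  else True.

Lemma prehomogeneous_color (r : nat) (C : eqType) (T : finType)
    (c : {set T} -> C) (s : seq (T * C)) (o : C) (e : {set T}) :
  prehomogeneous r c s -> #|e| = r.+1 ->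
  {subset e <= map fst [seq p <- s | p.2 == o]} -> c e = o.
Proof.
elim: s e => [|p s IHs] e /=.
  move=> _ he sub; have /card_gt0P[x /sub] : 0 < #|e| by rewrite he.
  by rewrite in_nil.
case=> hp hs he; case: eqP => [po|_] sub; last exact: IHs.
have [pe|pe] := boolP (p.1 \in e); last first.
  apply: IHs => // x xe; have := sub _ xe; rewrite inE => /orP[/eqP xp|//].
  by rewrite -xp xe in pe.
rewrite -(setD1K pe) hp //; last first.
  by have := cardsD1 p.1 e; rewrite pe he add1n => -[].
move=> x; rewrite !inE => /andP[xp /sub]; rewrite inE (negPf xp) /=.
by case/mapP=> y; rewrite mem_filter => /andP[_ ys] ->; apply: map_f.
Qed.

Lemma sum_count_color (C : finType) (T : Type) (s : seq (T * C)) :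
  \sum_(o : C) count (fun p => p.2 == o) s = size s.
Proof.
elim: s => [|p s IHs] /=; first by rewrite big1.
rewrite big_split /= IHs (bigD1 p.2) //= eqxx big1 ?addn0 // => o.
by rewrite eq_sym => /negPf->.
Qed.

Lemma ramsey (r : nat) (C : finType) (m : nat) :
  exists N, forall (T : finType) (c : {set T} -> C) (A : {set T}),
    N <= #|A| ->
    exists (M : {set T}) (o : C), [/\ M \subset A, m <= #|M| &
      forall e : {set T}, e \subset M -> #|e| = r -> c e = o].
Proof.
elim: r m => [|r IHr] m.
  exists m => T c A leA; exists A, (c set0); split=> // e _ /eqP.
  by rewrite cards_eq0 => /eqP->.
have pre k : exists N, forall (T : finType) (c : {set T} -> C) (A : {set T}),
    N <= #|A| -> exists s : seq (T * C),
      [/\ size s = k, uniq (map fst s), {subset map fst s <= A} &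
          prehomogeneous r c s].
  elim: k => [|k [N hN]]; first by exists 0 => T c A _; exists [::].
  have [N' hN'] := IHr N; exists N'.+1 => T c A leA.
  have /card_gt0P[x xA] : 0 < #|A| by apply: leq_trans leA.
  have leA' : N' <= #|A :\ x|.
    by rewrite (cardsD1 x A) xA add1n ltnS in leA.
  have [M [o [MA leM hM]]] := hN' T (fun e => c (x |: e)) _ leA'.
  have [s [ss us sM hs]] := hN T c M leM.
  have sA y : y \in map fst s -> y \in A :\ x.
    by move=> /sM; apply: (subsetP MA).
  exists ((x, o) :: s); split=> /=.
  - by rewrite ss.
  - by rewrite us andbT; apply/negP => /sA; rewrite !inE eqxx.
  - by move=> y; rewrite inE => /orP[/eqP->//|/sA]; rewrite inE => /andP[].
  - split=> // e es; apply: hM; apply/subsetP => y /es; exact: sM.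
have [N hN] := pre (#|C| * m).+1; exists N => T c A leA.
have [s [ss us sA hs]] := hN T c A leA.
have [o ho] : exists o : C, m <= count (fun p => p.2 == o) s.
  apply/existsP; apply: contraT; rewrite negb_exists => /forallP small.
  suff: size s <= #|C| * m by rewrite ss ltnn.
  rewrite -(sum_count_color s) -sum_nat_const; apply: leq_sum => o _.
  by have := small o; rewrite -ltnNge => /ltnW.
pose s' := map fst [seq p <- s | p.2 == o].
have us' : uniq s'.
  by apply: (subseq_uniq _ us); apply: map_subseq; apply: filter_subseq.
exists [set x in s'], o; split.
- apply/subsetP => x; rewrite inE => /mapP[p].
  by rewrite mem_filter => /andP[_ ps] ->; apply: sA; apply: map_f.
- by rewrite cardsE (card_uniqP us') size_map size_filter.
- move=> e eM he; apply: (prehomogeneous_color hs he) => x /(subsetP eM).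
  by rewrite inE.
Qed.

Lemma gallai_ramsey_exists (t r : nat) (H : 'I_t -> hypergraph r) :
  exists p, gallai_ramsey H p.
Proof.
pose m := maxn r (\max_(i < t) #|vertex (H i)|).
have [N hN] := ramsey r (option 'I_t) m; exists N.
apply/forallP => c; apply/implyP => _.
have leN : N <= #|[set: 'I_N]| by rewrite cardsT card_ord.
pose c' (e : {set 'I_N}) : option 'I_t :=
  if insub e is Some d then Some (c d) else None.
have [M [o [_ leM hM]]] := hN _ c' _ leN.
have c'E (e : {set 'I_N}) : #|e| = r ->
    exists2 d : edge (complete r N), val d = e & c' e = Some (c d).
  move=> he; rewrite /c'; case: insubP => [d _ <-|]; first by exists d.
  by rewrite inE he eqxx.
have /card_geqP[l [ul sl lM]] : r <= #|M| by apply: leq_trans leM; apply: leq_maxl.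
have lcard : #|[set x in l]| = r by rewrite cardsE (card_uniqP ul).
have lsub : [set x in l] \subset M by apply/subsetP => x; rewrite inE => /lM.
have [d0 _ cd0] := c'E _ lcard.
have oE := hM _ lsub lcard; rewrite cd0 in oE; subst o.
pose i := c d0; rewrite -/i in hM.
apply/existsP; exists i.
have leV : #|vertex (H i)| <= #|M|.
  by apply: leq_trans leM; rewrite leq_max; apply/orP; right; apply: leq_bigmax.
pose f := [ffun x : vertex (H i) => enum_val (widen_ord leV (enum_rank x))].
have finj : injective f.
  move=> x y; rewrite !ffunE => /enum_val_inj/(congr1 val)/= /val_inj.
  exact: enum_rank_inj.
have fM x : f x \in M by rewrite ffunE enum_valP.
pose S := [set d : edge (complete r N) |
  val d \in [set f @: (e : {set vertex (H i)}) | e in hyperedges (H i)]].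
have fcard (e : {set vertex (H i)}) : e \in hyperedges (H i) -> #|f @: e| = r.
  by move=> /hyperedges_uniform he; rewrite card_imset.
apply/existsP; exists S; apply/andP; split.
  apply/existsP; exists f; apply/andP; split; first exact/injectiveP.
  apply/eqP/setP => e; apply/imsetP/idP => [[d + ->]|]; first by rewrite inE.
  move=> eim; case/imsetP: (eim) => e' /fcard he' eE.
  have [d dE _] := c'E _ he'.
  by exists d; rewrite ?inE dE -?eE.
apply/forallP => d; apply/implyP; rewrite inE => /imsetP[e /fcard he dE].
have sub : f @: e \subset M by apply/subsetP => x /imsetP[y _ ->].
have [d' d'E] := c'E _ he; rewrite (hM _ sub he) => -[->].
by apply/eqP; congr (c _); apply: val_inj; rewrite d'E.
Qed.

Definition gr (t r : nat) (H : 'I_t -> hypergraph r) : nat :=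
  ex_minn (gallai_ramsey_exists H).

(* Main.v *)
Require Import Defs.
From mathcomp Require Import all_boot.

Set Implicit Arguments.
Unset Strict Implicit.
Unset Printing Implicit Defensive.

(** The lower bound comes from a product construction.  Let [c1] be a Gallai
coloring of the r-subsets of [A], with [#|A|] = gr(K_{p_1+1}, ..., K_{p_t+1}) - 1,
that has no clique of [p i + 1] vertices in color [i] for any [i], and let [c2]
be a coloring of the same kind on [B] for the [q i].  Replace each point of [A]
by a copy of [B], a block: the vertices become the pairs in [A * B].  An edge
that meets every block at most once is colored by [c1] on its first
coordinates, an edge inside one block is colored by [c2] on its second
coordinates, and any other, mixed, edge gets the last color [o]
([prod_color]).

The cliques are small.  A clique in color [i] meets fewer than [p i + 1]
blocks, since a choice of one vertex per block is a clique of [c1]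
([mono_fst]), and meets each block in fewer than [q i + 1] points
([mono_snd]).  For [i = o] this gives at most [p o * q o] vertices.  For
[i <> o] the clique contains no mixed edge, hence (as r >= 3) it lies inside
one block or meets every block at most once, so that it has at most
[maxn (p i) (q i)] vertices.

No r+1 vertices are rainbow.  If they are in distinct blocks or all in one
block, this is inherited from [c1] or [c2].  Otherwise two of their r-subsets
are mixed and share the color [o] ([repeats_prod]).

So the product coloring avoids everything that the Gallai-Ramsey number for
the combined sizes makes unavoidable, on [#|A| * #|B|] vertices, and that
number is therefore larger ([gr_gt_avoiding]). *)

(** * Subsets of a finite type *)

Lemma subset_between (T : finType) (n : nat) (D M : {set T}) :
  D \subset M -> #|D| <= n <= #|M| ->
  exists2 e : {set T}, D \subset e /\ e \subset M & #|e| = n.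
Proof.
elim: n => [|n IHn] DM /andP[leD leM].
  by exists D => //; apply/eqP; rewrite -leqn0.
move: leD; rewrite leq_eqVlt => /orP[/eqP eD|ltD]; first by exists D.
have [|e [De eM] en] := IHn DM; first by rewrite -ltnS ltD ltnW.
have /properP[_ [x xM xe]] : e \proper M.
  by rewrite properEcard eM en.
exists (x |: e); last by rewrite cardsU1 xe en.
split; last by rewrite subUset sub1set xM.
by apply: subset_trans De _; apply: subsetUr.
Qed.

(** Colors of edges of an image are compared with colors of edges upstairs by
lifting each edge to a set that [f] maps onto it bijectively. *)
Lemma imset_section (T U : finType) (f : T -> U) (M : {set T}) (e : {set U}) :
  e \subset f @: M ->
  exists d : {set T}, [/\ d \subset M, f @: d = e & {in d &, injective f}].
Proof.
move=> /subsetP eM.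
pose g u := [pick y in M | f y == u].
exists [set x in M | (f x \in e) && (g (f x) == Some x)]; split.
- by apply/subsetP => x; rewrite inE => /andP[].
- apply/setP => u; apply/imsetP/idP => [[x + ->]|ue].
    by rewrite inE => /and3P[].
  have : g u != None.
    rewrite /g; case: pickP => // none; have /imsetP[x xM ux] := eM _ ue.
    by have := none x; rewrite /= xM ux eqxx.
  case gu: (g u) => [x|] // _; move: (gu); rewrite /g.
  case: pickP => // y /andP[yM /eqP fy] [yx]; subst y.
  by exists x => //; rewrite inE yM fy ue -/(g u) gu eqxx.
- move=> x y; rewrite !inE => /and3P[_ _ /eqP gx] /and3P[_ _ /eqP gy] fxy.
  by apply: Some_inj; rewrite -gx -gy fxy.
Qed.

(** * Colorings of all the subsets of a type *)

(** Colorings are extended to all sets of vertices, so that edges need not be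
carried as elements of a subtype and colorings are pulled back along images;
only the values on r-subsets matter in what follows. *)
Definition mono (t r : nat) (T : finType) (c : {set T} -> 'I_t) (i : 'I_t)
    (M : {set T}) : Prop :=
  forall e : {set T}, e \subset M -> #|e| = r -> c e = i.

Definition repeats (t r : nat) (T : finType) (c : {set T} -> 'I_t)
    (W : {set T}) : Prop :=
  exists e e' : {set T},
    [/\ e != e', e \subset W /\ e' \subset W, #|e| = r /\ #|e'| = r & c e = c e'].

(** A Gallai coloring with no clique of [k i] vertices in color [i].  The bound
[#|M| < k i] on every clique amounts to the absence of a clique with exactly
[k i] vertices, as a subset of a clique is a clique. *)
Definition avoiding (t r : nat) (k : 'I_t -> nat) (T : finType)
    (c : {set T} -> 'I_t) : Prop :=
  (forall W : {set T}, #|W| = r.+1 -> repeats r c W) /\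
  (forall i (M : {set T}), mono r c i M -> #|M| < k i).

Lemma edge_of_card (r n : nat) (e : {set 'I_n}) :
  #|e| = r -> exists d : edge (complete r n), val d = e.
Proof.
move=> er; have ed : e \in hyperedges (complete r n) by rewrite inE er.
by exists (@exist _ (fun e => e \in hyperedges (complete r n)) e ed).
Qed.

Lemma card_edge (r n : nat) (d : edge (complete r n)) : #|val d| = r.
Proof. by have := valP d; rewrite inE => /eqP. Qed.

(** A copy of a complete hypergraph is determined by its vertex set: every
r-subset of the image of the embedding is the image of an r-subset. *)
Lemma is_copy_completeP (r m n : nat) (S : {set edge (complete r n)}) :
  reflect (exists2 W : {set 'I_n}, #|W| = m &
             S = [set d : edge (complete r n) | val d \subset W])
          (is_copy (complete r m) S).
Proof.
apply: (iffP existsP) => [[f /andP[/injectiveP finj /eqP SE]]|[W Wm ->]].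
  exists (f @: [set: 'I_m]); first by rewrite card_imset // cardsT card_ord.
  apply/setP => d; rewrite inE -(mem_imset _ _ val_inj) SE.
  apply/imsetP/idP => [[e _ ->]|dW]; first by apply/imsetS/subsetT.
  have /imset_section[e [_ fe _]] := dW.
  exists e => //; rewrite inE -(card_imset _ finj) fe.
  by have := valP d; rewrite inE.
have f0inj : injective (fun x : 'I_m => enum_val (cast_ord (esym Wm) x)).
  by move=> x y /enum_val_inj /cast_ord_inj.
pose f : {ffun 'I_m -> 'I_n} := [ffun x => enum_val (cast_ord (esym Wm) x)].
have finj : injective f.
  by move=> x y; rewrite !ffunE; apply: f0inj.
have fW : f @: [set: 'I_m] = W.
  apply/eqP; rewrite eqEcard card_imset // cardsT card_ord Wm leqnn andbT.
  by apply/subsetP => _ /imsetP[x _ ->]; rewrite ffunE enum_valP.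
exists f; apply/andP; split; first exact/injectiveP.
apply/eqP/setP => e.
apply/imsetP/imsetP => [[d + ->]|[e']].
  rewrite inE -fW => /imset_section[e' [_ fe _]]; exists e' => //.
  by rewrite inE -(card_imset _ finj) fe; have := valP d; rewrite inE.
rewrite inE => /eqP er ->.
have [d de] := edge_of_card (etrans (card_imset (mem e') finj) er).
by exists d; rewrite ?inE de // -fW; apply/imsetS/subsetT.
Qed.

Section Transfer.
Variables (t r n : nat) (k : 'I_t -> nat).
Let H i := complete r (k i).

Lemma avoiding_not_ramsey (c : {set 'I_n} -> 'I_t) :
  avoiding r k c -> ~~ gallai_ramsey H n.
Proof.
case=> cW cM; apply/negP => /forallP/(_ [ffun d => c (val d)])/implyP ram.
have {ram}/ram : gallai [ffun d : edge (complete r n) => c (val d)].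
  apply/forallP => S; apply/implyP => /is_copy_completeP[W Wr ->].
  have [e [e' [ne [eW e'W] [er er'] ce]]] := cW _ Wr.
  have [[d de] [d' de']] := (edge_of_card er, edge_of_card er').
  apply/negP => /dinjectiveP inj; case/eqP: ne.
  by rewrite -de -de' (inj d d') ?inE ?de ?de' // !ffunE de de'.
case/existsP=> i /existsP[S /andP[/is_copy_completeP[W Wk ->] /forallP mS]].
suff /cM : mono r c i W by rewrite Wk ltnn.
move=> e eW er; have [d de] := edge_of_card er.
by have := mS d; rewrite inE de eW ffunE de => /eqP.
Qed.

(** The color [o] is a dummy value for the sets that are not edges. *)
Lemma not_ramsey_avoiding (o : 'I_t) :
  ~~ gallai_ramsey H n -> exists c : {set 'I_n} -> 'I_t, avoiding r k c.
Proof.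
rewrite negb_forall => /existsP[c]; rewrite negb_imply.
case/andP=> /forallP gc /existsPn mc.
pose c' (e : {set 'I_n}) :=
  if insub e is Some d then c (d : edge (complete r n)) else o.
have c'E (d : edge (complete r n)) : c' (val d) = c d by rewrite /c' valK.
exists c'; split=> [W Wr|i M mM].
  have := gc [set d : edge (complete r n) | val d \subset W].
  rewrite (introT (is_copy_completeP _ _)) /=.
    case/dinjectivePn=> d; rewrite inE => dW [d']; rewrite !inE.
    case/andP=> nd d'W cd; exists (val d), (val d'); split=> //.
    - by rewrite (inj_eq val_inj) eq_sym.
    - by rewrite !card_edge.
    - by rewrite !c'E.
  by exists W.
rewrite ltnNge; apply/negP => kM.
have [||W [_ WM] Wk] := @subset_between _ (k i) set0 M.
- exact: sub0set.
- by rewrite cards0.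
case/existsP: (mc i); exists [set d : edge (complete r n) | val d \subset W].
apply/andP; split.
  by apply/is_copy_completeP; exists W.
apply/forallP => d; apply/implyP; rewrite inE => dW.
by rewrite -c'E mM ?card_edge //; apply: subset_trans WM.
Qed.

End Transfer.

(** Restriction of an avoiding coloring to a smaller vertex set; it carries a
coloring of [A * B] over to ['I_n] for every [n <= #|A| * #|B|]. *)
Lemma avoiding_inj (t r : nat) (k : 'I_t -> nat) (T U : finType) (g : U -> T)
    (c : {set T} -> 'I_t) :
  injective g -> avoiding r k c -> avoiding r k (fun e => c (g @: e)).
Proof.
move=> ginj [cW cM]; split=> [W Wr|i M mM].
  have [|e [e' [ne [eW e'W] [er er'] ce]]] := cW (g @: W).
    by rewrite card_imset.
  have [d [dW de _]] := imset_section eW.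
  have [d' [dW' de' _]] := imset_section e'W.
  exists d, d'; split=> //; last by rewrite de de'.
  - by apply: contraNneq ne => dd; rewrite -de -de' dd.
  - by rewrite -!(card_imset _ ginj) de de'.
rewrite -(card_imset _ ginj); apply: cM => e eM er.
have [d [dM de _]] := imset_section eM.
by rewrite -de mM // -(card_imset _ ginj) de.
Qed.

(** * The product coloring *)

Section Product.
Variables (t r : nat) (A B : finType) (o : 'I_t).
Variables (c1 : {set A} -> 'I_t) (c2 : {set B} -> 'I_t).

(** The test [#|fst @: e| == #|e|] holds when [e] meets each block [a * B] at
most once, and [#|fst @: e| <= 1] when [e] lies inside one block. *)
Definition prod_color (e : {set A * B}) : 'I_t :=
  if #|fst @: e| == #|e| then c1 (fst @: e)
  else if #|fst @: e| <= 1 then c2 (snd @: e) else o.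

Lemma prod_color_transversal (e : {set A * B}) :
  {in e &, injective fst} -> prod_color e = c1 (fst @: e).
Proof. by move=> inj; rewrite /prod_color card_in_imset ?eqxx. Qed.

Lemma prod_color_block (a : A) (e : {set A * B}) :
  {in e, forall x, x.1 = a} -> 1 < #|e| -> prod_color e = c2 (snd @: e).
Proof.
move=> ea lte; rewrite /prod_color.
have le1 : #|fst @: e| <= 1.
  rewrite -(cards1 a); apply/subset_leq_card/subsetP => _ /imsetP[x /ea xa ->].
  by rewrite inE xa.
by rewrite le1 ltn_eqF //; apply: leq_trans lte.
Qed.

Lemma prod_color_mixed (e : {set A * B}) (x y z : A * B) :
  x \in e -> y \in e -> z \in e -> x != y -> x.1 = y.1 -> z.1 != x.1 ->
  prod_color e = o.
Proof.
move=> xe ye ze nxy xy nzx; rewrite /prod_color.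
case: eqP => [/eqP/imset_injP inj|_]; first by rewrite (inj x y) ?eqxx in nxy.
case: leqP => // le1; case/negP: nzx; apply/eqP.
by apply: (card_le1_eqP le1); apply: imset_f.
Qed.

Lemma block_snd_inj (a : A) (M : {set A * B}) :
  {in M, forall x, x.1 = a} -> {in M &, injective snd}.
Proof.
by move=> Ma [x1 x2] [y1 y2] /Ma/= -> /Ma/= -> /= ->.
Qed.

(** The trichotomy behind both halves of the argument: a set that is neither
transversal to the blocks nor inside one contains three vertices that force
any edge through them to be mixed. *)
Variant shape (M : {set A * B}) : Prop :=
  | Transversal of {in M &, injective fst}
  | Block a of {in M, forall x, x.1 = a}
  | Mixed x y z of [/\ x \in M, y \in M & z \in M] &
      [/\ x != y, x.1 = y.1 & z.1 != x.1].

Lemma shapeP (M : {set A * B}) : shape M.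
Proof.
case: (boolP (dinjectiveb fst M)) => [/dinjectiveP|/dinjectivePn[x xM [y]]].
  exact: Transversal.
rewrite !inE => /andP[nyx yM] xy.
case: (boolP [forall z in M, z.1 == x.1]) => [/forall_inP Mx|].
  by apply: (@Block _ x.1) => z /Mx/eqP.
case/forall_inPn=> z zM nzx; apply: (@Mixed _ x y z) => //.
by split=> //; rewrite eq_sym.
Qed.

Hypothesis (hr : 3 <= r).

(** One vertex chosen in each block of a clique: the chosen edges are
transversal, so [c1] decides their color. *)
Lemma mono_fst (i : 'I_t) (M : {set A * B}) :
  mono r prod_color i M -> mono r c1 i (fst @: M).
Proof.
move=> mM e eM er; have [d [dM de inj]] := imset_section eM.
rewrite -de -prod_color_transversal //; apply: mM => //.
by rewrite -(card_in_imset inj) de.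
Qed.

Lemma mono_snd (i : 'I_t) (a : A) (M : {set A * B}) :
  mono r prod_color i M -> {in M, forall x, x.1 = a} -> mono r c2 i (snd @: M).
Proof.
move=> mM Ma e eM er; have [d [dM de inj]] := imset_section eM.
have dr : #|d| = r by rewrite -(card_in_imset inj) de.
rewrite -de -(@prod_color_block a) ?dr; last exact: ltnW.
  exact: mM.
by move=> x /(subsetP dM)/Ma.
Qed.

(** For a mixed [W] with [x], [y] in one block and [z] in another, [r.+1 >= 4]
provides a fourth vertex [w].  Removing [w] leaves a mixed edge.  If [w] lies
in the block of [x], removing [y] leaves one too, through [x], [w], [z];
otherwise removing [z] does, through [x], [y], [w]. *)
Lemma repeats_prod (W : {set A * B}) :
  (forall W1 : {set _}, #|W1| = r.+1 -> repeats r c1 W1) ->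
  (forall W2 : {set _}, #|W2| = r.+1 -> repeats r c2 W2) ->
  #|W| = r.+1 -> repeats r prod_color W.
Proof.
move=> h1 h2 Wr.
case: (shapeP W) => [inj|a Wa|x y z [xW yW zW] [nxy xy nzx]].
- have [|e [e' [ne [eW e'W] [er er'] ce]]] := h1 (fst @: W).
    by rewrite card_in_imset.
  have [d [dW de dinj]] := imset_section eW.
  have [d' [dW' de' dinj']] := imset_section e'W.
  exists d, d'; split=> //.
  + by apply: contraNneq ne => dd; rewrite -de -de' dd.
  + by rewrite -(card_in_imset dinj) -(card_in_imset dinj') de de'.
  + by rewrite !prod_color_transversal // de de'.
- have [|e [e' [ne [eW e'W] [er er'] ce]]] := h2 (snd @: W).
    by rewrite card_in_imset //; apply: block_snd_inj Wa.
  have [d [dW de dinj]] := imset_section eW.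
  have [d' [dW' de' dinj']] := imset_section e'W.
  have dr : #|d| = r by rewrite -(card_in_imset dinj) de.
  have dr' : #|d'| = r by rewrite -(card_in_imset dinj') de'.
  have lt1r : 1 < r by apply: ltnW.
  exists d, d'; split=> //.
  + by apply: contraNneq ne => dd; rewrite -de -de' dd.
  + by rewrite !(@prod_color_block a) ?de ?de' ?dr ?dr' // => u;
      [move/(subsetP dW')/Wa | move/(subsetP dW)/Wa].
have [w wW] : exists2 w, w \in W & w \notin [set x; y; z].
  apply/subsetPn/negP => /subset_leq_card; rewrite Wr.
  have := leq_card_setU [set x; y] [set z]; rewrite cards1 cards2 nxy => le3 le4.
  by have := leq_trans (leq_trans le4 le3) hr; rewrite ltnn.
rewrite !inE !negb_or -andbA => /and3P[nwx nwy nwz].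
have nzx' : z != x by apply: contraNneq nzx => ->.
have nzy : z != y by apply: contraNneq nzx => ->; rewrite xy.
have two u v : u \in W -> v \in W -> u != v ->
    prod_color (W :\ u) = o -> prod_color (W :\ v) = o -> repeats r prod_color W.
  move=> uW vW nuv cu cv; exists (W :\ u), (W :\ v); split.
  - apply/eqP => /setP/(_ v); rewrite !inE eqxx vW andbT /=.
    by rewrite eq_sym nuv.
  - by split; apply: subD1set.
  - have := cardsD1 u W; have := cardsD1 v W.
    by rewrite Wr uW vW !add1n => -[<-] [<-].
  - by rewrite cu cv.
have cw : prod_color (W :\ w) = o.
  by apply: (@prod_color_mixed _ x y z) => //; rewrite !inE eq_sym ?nwx ?nwy ?nwz.
have [wx|nwx1] := eqVneq w.1 x.1.
  apply: (two w y) => //; apply: (@prod_color_mixed _ x w z) => //;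
    by rewrite ?inE ?nxy ?nwy ?nzy // eq_sym.
apply: (two w z) => //; apply: (@prod_color_mixed _ x y w) => //;
  by rewrite !inE ?nwz // eq_sym ?nzx' ?nzy.
Qed.

(** The assumption [r <= k1 i] disposes of the sets with fewer than [r]
vertices, which contain no edge and are thus cliques in every color.  For a
clique in color [o], the predecessors appear because [k1 o] and [k2 o] are
strict bounds. *)
Lemma avoiding_prod (k1 k2 k : 'I_t -> nat) :
  (forall i, r <= k1 i) ->
  (forall i, i != o -> maxn (k1 i) (k2 i) <= k i) ->
  (k1 o).-1 * (k2 o).-1 < k o ->
  avoiding r k1 c1 -> avoiding r k2 c2 -> avoiding r k prod_color.
Proof.
move=> k1r kmax ko [h1 m1] [h2 m2]; split=> [W|i M mM].
  exact: repeats_prod.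
have lt1 := m1 _ _ (mono_fst mM).
have lt2 a (M' : {set A * B}) :
    M' \subset M -> {in M', forall x, x.1 = a} -> #|M'| < k2 i.
  move=> M'M M'a; rewrite -(card_in_imset (block_snd_inj M'a)).
  apply: m2; apply: mono_snd M'a => e /subset_trans eM'.
  by apply: mM; apply: eM'.
have [io|nio] := eqVneq i o.
  (* The clique is counted block by block. *)
  subst i; apply: leq_ltn_trans ko.
  rewrite -sum1_card (partition_big_imset fst) /=.
  apply: (@leq_trans (\sum_(a in fst @: M) (k2 o).-1)).
    apply: leq_sum => a _; rewrite sum1dep_card -ltnS.
    have lta : #|[set x in M | x.1 == a]| < k2 o.
      apply: (lt2 a) => [|x]; last by rewrite inE => /andP[_ /eqP].
      by apply/subsetP => x; rewrite inE => /andP[].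
    by rewrite (ltn_predK lta).
  by rewrite sum_nat_const leq_mul2r -ltnS (ltn_predK lt1) lt1 orbT.
have := kmax _ nio; rewrite geq_max => /andP[le1 le2].
have [lt|leM] := ltnP #|M| r.
  by apply: leq_trans le1; apply: leq_trans (k1r i).
case: (shapeP M) => [inj|a Ma|x y z [xM yM zM] [nxy xy nzx]].
- by apply: leq_trans le1; rewrite -(card_in_imset inj).
- by apply: leq_trans le2; apply: lt2 Ma.
(* A mixed edge inside the clique would force its color to be [o]. *)
have [||e [De eM] er] := @subset_between _ r [set x; y; z] M.
- by rewrite !subUset !sub1set xM yM.
- rewrite leM andbT; apply: leq_trans hr.
  by apply: leq_trans (leq_card_setU _ _) _; rewrite cards1 cards2 nxy.
case/eqP: nio; rewrite -(mM e eM er); apply: (@prod_color_mixed _ x y z) => //;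
  by apply: (subsetP De); rewrite !inE eqxx ?orbT.
Qed.

End Product.

(** * Gallai-Ramsey numbers *)

Lemma gr_leq (t r : nat) (H : 'I_t -> hypergraph r) (n : nat) :
  gallai_ramsey H n -> gr H <= n.
Proof. by rewrite /gr; case: ex_minnP => m _; apply. Qed.

Lemma gr_ramsey (t r : nat) (H : 'I_t -> hypergraph r) : gallai_ramsey H (gr H).
Proof. by rewrite /gr; case: ex_minnP. Qed.

(** Minimality of the Gallai-Ramsey number gives the coloring, provided that
number is positive.  With truncated subtraction the value 0 needs its own
argument: a coloring without vertices avoids every nonempty clique. *)
Lemma avoiding_pred_gr (t r : nat) (k : 'I_t -> nat) (o : 'I_t) :
  (forall i, 0 < k i) ->
  exists c : {set 'I_(gr (fun i => complete r (k i)) - 1)} -> 'I_t,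
    avoiding r k c.
Proof.
move=> k0; apply: (not_ramsey_avoiding o); set g := gr _.
have [g0|g0] := posnP g.
  rewrite g0; apply: (@avoiding_not_ramsey _ _ _ _ (fun=> o)).
  have card0 (W : {set 'I_0}) : #|W| = 0.
    by apply/eqP; rewrite -leqn0 -[X in _ <= X]card_ord max_card.
  by split=> [W|i M _]; rewrite card0.
by apply/negP => /gr_leq; rewrite -/g leqNgt ltn_subrL g0.
Qed.

Lemma gr_gt_avoiding (t r : nat) (k : 'I_t -> nat) (T : finType)
    (c : {set T} -> 'I_t) :
  avoiding r k c -> #|T| < gr (fun i => complete r (k i)).
Proof.
move=> av; rewrite ltnNge; apply/negP => le.
have := gr_ramsey (fun i => complete r (k i)); apply/negP.
pose g x : T := enum_val (widen_ord le x).
have ginj : injective g by move=> x y /enum_val_inj/(congr1 val)/= /val_inj.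
exact: avoiding_not_ramsey (avoiding_inj ginj av).
Qed.

Theorem theorem6 (t r : nat) (p q : 'I_t -> nat) (ht : 1 <= t) (hr : 3 <= r)
    (hp : forall i : 'I_t, r - 1 <= p i) (hq : forall i : 'I_t, r - 1 <= q i) :
  (gr (fun i : 'I_t => complete r (p i + 1)) - 1) *
  (gr (fun i : 'I_t => complete r (q i + 1)) - 1) + 1
  <= gr (fun i : 'I_t => complete r
       (if i.+1 == t then p i * q i + 1 else maxn (p i) (q i) + 1)).
Proof.
have tK : t.-1.+1 = t by rewrite prednK.
pose o : 'I_t := Ordinal (eq_leq tK).
have oE (i : 'I_t) : (i.+1 == t) = (i == o).
  by rewrite -[RHS]eqSS /= tK.
have pos (f : 'I_t -> nat) (i : 'I_t) : 0 < f i + 1 by rewrite addn1.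
have [c1 av1] := @avoiding_pred_gr t r _ o (pos p).
have [c2 av2] := @avoiding_pred_gr t r _ o (pos q).
rewrite addn1 -[X in X * _]card_ord -[X in _ * X]card_ord -card_prod.
apply: (@gr_gt_avoiding _ _ _ _ (prod_color o c1 c2)).
apply: avoiding_prod av1 av2 => // [i|i nio|].
- by rewrite addnC -leq_subLR.
- by rewrite oE (negPf nio) addn_maxl.
- by rewrite oE eqxx !addn1.
Qed.
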